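(* Let $GF(q')$ be a finite field of order $q'=q^{2\beta}$, where $\beta\in\mathbb{N}$ and $q$ is a power of a prime $p$. Let $e\mid q+1$ and set $\eta=\frac{(-q)^\beta-1}{e}$. Let $I\subset\{0,1,\ldots,e-1\}$ with $|I|=u$, $2\le u\le e-1$, and $\mathcal{D}'=\{C_i^e\}_{i\in I}$. Then: (i) each $C_i^e$ is a regular $(q',\frac{q'-1}{e},\eta^2-(e-3)\eta-1,\eta^2+\eta)$-partial difference set; (ii) $\mathcal{D}'$ is a $(q',u,\frac{q'-1}{e},u\eta^2+(u+2-e)\eta-1,u(\eta^2+\eta))$-disjoint partial difference family and a $(q',u,\frac{q'-1}{e},u(u-1)\eta^2+2(u-1)\eta,u(u-1)\eta^2)$-external partial difference family; (iii) $D=\bigcup_{i\in I}C_i^e$ is a regular $(q',\frac{u(q'-1)}{e},u^2\eta^2+(3u-e)\eta-1,u^2\eta^2+u\eta)$-partial difference set, which is proper except when $\eta=1=2u-e$ or $\eta=-1=2u-e$.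
   Context: All difference notions are in $G=(GF(q'),+)$, $G^*=G\setminus\{0\}$. $\alpha$ is a primitive element of $GF(q')$ and $C_i^e=\alpha^i\langle\alpha^e\rangle$ ($0\le i\le e-1$) are the cyclotomic classes of order $e$ (note $e\mid q'-1$). $\Delta(D)$ is the multiset $\{x-y:x,y\in D,x\neq y\}$, $\Delta(D_1,D_2)=\{x-y:x\in D_1,y\in D_2\}$ (multiset), and $\lambda A$ is $\lambda$ copies of each element of $A$. A $k$-subset $P$ is a $(q',k,\lambda,\mu)$-partial difference set if $\Delta(P)=\lambda P+\mu(G^*\setminus P)$; it is proper if $\lambda\neq\mu$ and regular if $P=-P$ and $0\notin P$. A family $\{D_1,\dots,D_m\}$ of disjoint $k$-subsets of $G^*$ with union $S$ is a $(q',m,k,\lambda,\mu)$-disjoint partial difference family if $\bigcup_i\Delta(D_i)=\lambda S+\mu(G^*\setminus S)$, and a $(q',m,k,\lambda,\mu)$-external partial difference family if $\bigcup_{i\neq j}\Delta(D_i,D_j)=\lambda S+\mu(G^*\setminus S)$. *)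

(* Defs.v *)
Set Warnings "-notation-overridden,-ambiguous-paths,-notation-incompatible-prefix".
From mathcomp Require Export all_boot all_order all_fingroup all_algebra all_solvable.
From mathcomp Require Export finmap multiset.

Set Implicit Arguments.
Unset Strict Implicit.
Unset Printing Implicit Defensive.

Import GRing.Theory.
Local Open Scope ring_scope.

Section DifferenceStructures.

Variable G : finZmodType.
Implicit Types (P A B : {set G}) (v m k : nat) (lambda mu : int).

Definition nonzero : {set G} := [set~ 0].

Definition Delta A : {mset G}%mset :=
  seq_mset [seq z.1 - z.2 | z in [set z : G * G |
              [&& z.1 \in A, z.2 \in A & z.1 != z.2]]].

Definition Delta2 A B : {mset G}%mset :=
  seq_mset [seq z.1 - z.2 | z in setX A B].

Definition copies (n : nat) A : {mset G}%mset :=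
  iter n (msetD (seq_mset (enum A))) mset0.

(* The multiset X is lambda A + mu (G^* \ A). The parameters are integers, since
   they are given by formulas involving subtraction; a number of copies has to
   be nonnegative. *)
Definition has_multiplicities (X : {mset G}%mset) A lambda mu : Prop :=
  [/\ 0 <= lambda, 0 <= mu &
      X = msetD (copies `|lambda|%N A) (copies `|mu|%N (nonzero :\: A))].

Definition is_PDS P v k lambda mu : Prop :=
  [/\ #|G| = v, #|P| = k & has_multiplicities (Delta P) P lambda mu].

Definition is_proper_PDS P v k lambda mu : Prop :=
  is_PDS P v k lambda mu /\ lambda <> mu.

Definition is_regular_PDS P v k lambda mu : Prop :=
  [/\ is_PDS P v k lambda mu, P = [set - x | x in P] & 0 \notin P].

Section Families.

(* A family is a map D on an index type J, restricted to the index set I. *)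
Variables (J : finType) (I : {set J}) (D : J -> {set G}).

Definition disjoint_family v m k : Prop :=
  [/\ #|G| = v,
      #|I| = m,
      {in I, forall i, #|D i| = k /\ D i \subset nonzero} &
      {in I &, forall i j, i != j -> [disjoint D i & D j]}].

Definition family_union : {set G} := \bigcup_(i in I) D i.

Definition is_DPDF v m k lambda mu : Prop :=
  disjoint_family v m k /\
  has_multiplicities (\big[@msetD G/mset0]_(i in I) Delta (D i))
    family_union lambda mu.

Definition is_EPDF v m k lambda mu : Prop :=
  disjoint_family v m k /\
  has_multiplicities
    (\big[@msetD G/mset0]_(z in setX I I | z.1 != z.2) Delta2 (D z.1) (D z.2))
    family_union lambda mu.

End Families.

End DifferenceStructures.

Definition primitive_element (F : finFieldType) (alpha : {unit F}) : Prop :=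
  generator [set: {unit F}] alpha.

(* The left coset alpha^i <alpha^e> of the group of units, as a subset of F. *)
Definition cyclotomic_class (F : finFieldType) (alpha : {unit F}) (e i : nat) :
    {set F} :=
  [set val x | x in (alpha ^+ i *: <[alpha ^+ e]>)%g].

(* This floor quotient is exact when e divides q + 1. *)
Definition cyclotomic_eta (q beta e : nat) : int :=
  (((- q%:Z) ^+ beta - 1) %/ e%:Z)%Z.

(* Main.v *)
(** Put N = q + 1 and let psi be a nontrivial additive character of F with values
in the algebraic numbers. The exponent in S(c) = sum_x psi(c x^N) is a Hermitian
form over GF(q): the substitution x = y + t in |S(c)|^2 leaves a sum over the
t such that c t^N annihilates the image of w |-> w^q + w under psi. These
annihilators form a GF(q)-line b0 GF(q), contained in a single class of order N
together with 0, so that |S(c)|^2 is q' q^2 if c / b0 is an N-th power, and q'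
otherwise. Moreover S(c) is an integer (it is rational because the classes of
order N are stable under scaling by GF(q)) congruent to 1 modulo N, which
determines its sign: S(c) = (-q)^(beta+1) or (-q)^beta. Averaging over C_0^e, and
writing s = (-q)^beta = e eta + 1, the Fourier transform of C_i^e at c <> 0 is
eta, minus s when c alpha^i / b0 lies in C_0^e. Fourier inversion then gives,
for z <> 0, the number of representations z = x - y with x in C_i and y in C_j:
  eta^2 + eta ([z in C_i] + [z in C_j]) + [i = j] (eta - s [z in C_i]),
and all the parameters are obtained by summing this over pairs of indices. *)

Require Import Defs.
From mathcomp Require Import all_field all_character ring zify.

Set Implicit Arguments.
Unset Strict Implicit.
Unset Printing Implicit Defensive.

Import GRing.Theory Order.TTheory Num.Theory.
Local Open Scope ring_scope.

(** * Difference multisets as counting functions *)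

Section DifferenceCounts.

Variable G : finZmodType.
Implicit Types (A B : {set G}) (z : G).

Definition diff_count A B z : nat :=
  (\sum_(x in A) \sum_(y in B) ((x - y)%R == z))%N.

Lemma count_image (T : finType) (f : T -> G) (A : {pred T}) z :
  count_mem z [seq f x | x in A] = (\sum_(x in A) (f x == z))%N.
Proof.
rewrite count_map -sum1_count big_mkcond big_enum /=.
by apply: eq_bigr => x _; case: (f x == z).
Qed.

Lemma Delta2E A B z : Delta2 A B z = diff_count A B z.
Proof.
rewrite /Delta2 mset_seqE count_image /diff_count pair_big /=.
by apply: eq_bigl => -[x y]; rewrite !inE.
Qed.

Lemma DeltaE A z : Delta A z = if z == 0 then 0%N else diff_count A A z.
Proof.
rewrite /Delta mset_seqE count_image.
have [->|z0] := eqVneq z 0.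
  by rewrite big1 // => -[x y]; rewrite inE /= subr_eq0 => /and3P[_ _ /negbTE->].
rewrite /diff_count pair_big /= [LHS]big_mkcond [RHS]big_mkcond /=.
apply: eq_bigr => -[x y] _; rewrite !inE /= andbA.
have [->|] := eqVneq x y; rewrite ?andbT //= andbF subrr eq_sym (negbTE z0).
by case: ifP.
Qed.

Lemma copiesE n A z : copies n A z = (n * (z \in A))%N.
Proof.
rewrite /copies; elim: n => [|n IH]; first by rewrite mset0E.
by rewrite iterS msetE2 IH mset_seqE count_uniq_mem ?enum_uniq // mem_enum mulSn.
Qed.

Lemma mset_sumE (T : finType) (P : pred T) (X : T -> {mset G}%mset) z :
  (\big[@msetD G/mset0]_(i | P i) X i)%mset z = (\sum_(i | P i) X i z)%N.
Proof.
by elim/big_rec2: _ => [|i m Y _ <-]; rewrite ?mset0E ?msetE2.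
Qed.

(** Both [A] and its complement among the nonzero elements are inhabited, so [lambda] and [mu] are
    attained as counts; this gives the nonnegativity that [has_multiplicities] demands of these
    integers. *)
Lemma has_multiplicitiesP (X : {mset G}%mset) A (lambda mu : int) :
    X 0 = 0%N -> 0 \notin A -> A != set0 -> nonzero G :\: A != set0 ->
    (forall z, z != 0 -> (X z)%:Z = if z \in A then lambda else mu) ->
  has_multiplicities X A lambda mu.
Proof.
move=> X0 nA0 /set0Pn[x xA] /set0Pn[y]; rewrite !inE => /andP[nyA y0] XE.
have x0 : x != 0 by apply: contraNneq nA0 => <-.
have lambda_ge0 : 0 <= lambda by have := XE x x0; rewrite xA => <-.
have mu_ge0 : 0 <= mu by have := XE y y0; rewrite (negbTE nyA) => <-.
split=> //; apply/msetP=> z; rewrite msetE2 !copiesE !inE.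
have [->|z0] := eqVneq z 0; first by rewrite X0 (negbTE nA0) andbF !muln0.
rewrite andbT; have := XE z z0; case: (z \in A) => /= XzE.
  by rewrite muln1 muln0 addn0; lia.
by rewrite muln1 muln0 add0n; lia.
Qed.

Lemma diff_count_disjoint0 A B : [disjoint A & B] -> diff_count A B 0 = 0%N.
Proof.
move=> dAB; rewrite /diff_count big1 // => x xA; rewrite big1 // => y yB.
rewrite subr_eq0; case: eqP => // xy.
by rewrite -xy (disjointFr dAB xA) in yB.
Qed.

(** Disjointness leaves at most one nonzero term, so indicators add up over the family; sums over
    the union then split. *)
Lemma mem_bigcup_disjoint (J : finType) (I : {set J}) (D : J -> {set G}) z :
    {in I &, forall i j, i != j -> [disjoint D i & D j]} ->
  (z \in \bigcup_(i in I) D i) = (\sum_(i in I) (z \in D i))%N :> nat.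
Proof.
move=> dD; have [/bigcupP[i iI zi]|zU] := boolP (z \in _).
  rewrite (bigD1 i) //= zi big1 // => j /andP[jI ji].
  by rewrite (disjointFl (dD _ _ jI iI ji) zi).
rewrite big1 // => i iI; rewrite (_ : z \in _ = false) //.
by apply: contraNF zU => zi; apply/bigcupP; exists i.
Qed.

Lemma sum_bigcup_disjoint (J : finType) (I : {set J}) (D : J -> {set G})
    (f : G -> nat) : {in I &, forall i j, i != j -> [disjoint D i & D j]} ->
  (\sum_(x in \bigcup_(i in I) D i) f x = \sum_(i in I) \sum_(x in D i) f x)%N.
Proof.
move=> dD; under [RHS]eq_bigr do rewrite big_mkcond.
rewrite exchange_big [LHS]big_mkcond /=; apply: eq_bigr => x _.
transitivity ((x \in \bigcup_(i in I) D i) * f x)%N.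
  by case: (x \in _); rewrite ?mul1n.
rewrite mem_bigcup_disjoint // big_distrl /=; apply: eq_bigr => i _.
by case: (x \in _); rewrite ?mul1n.
Qed.

Lemma diff_count_bigcup (J : finType) (I : {set J}) (D : J -> {set G}) z :
    {in I &, forall i j, i != j -> [disjoint D i & D j]} ->
  diff_count (\bigcup_(i in I) D i) (\bigcup_(i in I) D i) z =
    (\sum_(i in I) \sum_(j in I) diff_count (D i) (D j) z)%N.
Proof.
move=> dD; rewrite /diff_count sum_bigcup_disjoint //; apply: eq_bigr => i _.
by under eq_bigr => x _ do rewrite sum_bigcup_disjoint //; rewrite exchange_big.
Qed.

Lemma opp_imset A : (forall x, (- x \in A) = (x \in A)) -> A = [set - x | x in A].
Proof.
move=> AN; apply/setP=> x; apply/idP/imsetP => [xA|[y yA ->]]; last by rewrite AN.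
by exists (- x); rewrite ?AN ?opprK.
Qed.

End DifferenceCounts.

(** * Cyclotomic classes through discrete logarithms *)

Section CyclotomicClasses.

Variables (F : finFieldType) (alpha : {unit F}).
Hypothesis alpha_prim : primitive_element alpha.

Local Notation n := (#|F|.-1).
Local Notation g := (val alpha).
Local Notation C := (cyclotomic_class alpha).

Lemma order_primitive : #[alpha]%g = n.
Proof. by rewrite orderE -(eqP alpha_prim) card_finField_unit. Qed.

Lemma primitive_neq0 : g != 0.
Proof. by rewrite -unitfE (valP alpha). Qed.

Lemma primitive_log (x : F) : x != 0 -> exists m : nat, x = g ^+ m.
Proof.
move=> x0; have ux : x \is a GRing.unit by rewrite unitfE.
have : FinRing.Unit ux \in <[alpha]>%g by rewrite -(eqP alpha_prim) inE.
case/cycleP=> m /(congr1 val) /= ->; exists m.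
by rewrite FinRing.val_unitX.
Qed.

Lemma eq_primitive_exp i j : (g ^+ i == g ^+ j) = (i == j %[mod n]).
Proof.
by rewrite -order_primitive -eq_expg_mod_order -!FinRing.val_unitX (inj_eq val_inj).
Qed.

(** Logarithms turn membership in a coset into a congruence. Exponents are determined modulo [n],
    hence modulo its divisor [e]. *)
Lemma mem_class_exp e i m : (e %| n)%N ->
  (g ^+ m \in C e i) = (m == i %[mod e]).
Proof.
move=> en; rewrite /cyclotomic_class -FinRing.val_unitX.
rewrite mem_imset; last exact: val_inj.
rewrite mem_lcoset.
have n0 : (0 < n)%N by rewrite -order_primitive order_gt0.
apply/idP/eqP => [/cycleP[k]|mi].
  move=> /(canRL (mulKVg _)); rewrite -expgM -expgD => /eqP.
  rewrite eq_expg_mod_order order_primitive => /eqP mE.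
  by rewrite -(modn_dvdm m en) mE modn_dvdm // mulnC addnC modnMDl.
(* Modulo [n], the exponent [i * n.-1] stands for [- i], so that only natural exponents remain. *)
have -> : (alpha ^- i * alpha ^+ m = alpha ^+ (m + i * n.-1))%g.
  apply: (mulgI (alpha ^+ i)%g); rewrite mulKVg -expgD.
  apply/eqP; rewrite eq_expg_mod_order order_primitive.
  have -> : (i + (m + i * n.-1) = m + i * n)%N by nia.
  by rewrite addnC modnMDl.
have /dvdnP[k ->] : (e %| m + i * n.-1)%N.
  rewrite /dvdn -modnDml mi modnDml.
  have -> : (i + i * n.-1 = i * n)%N by nia.
  exact: dvdn_mull.
by rewrite mulnC expgM mem_cycle.
Qed.

Lemma card_class e i : (e %| n)%N -> #|C e i| = (n %/ e)%N.
Proof.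
move=> en; rewrite /cyclotomic_class card_imset; last exact: val_inj.
by rewrite card_lcoset -orderE orderXdiv order_primitive.
Qed.

Lemma class_neq0 e i x : x \in C e i -> x != 0.
Proof. by case/imsetP=> y _ ->; rewrite -unitfE (valP y). Qed.

Lemma class0 e i : 0 \notin C e i.
Proof. by apply/negP=> /class_neq0; rewrite eqxx. Qed.

(** [C e 0] is a subgroup and [C e i] one of its cosets; [y = 0] is harmless since no class contains
    0. *)
Lemma mem_classM e i x y : (e %| n)%N -> x \in C e 0 ->
  (x * y \in C e i) = (y \in C e i).
Proof.
move=> en xC; have [->|y0] := eqVneq y 0; first by rewrite mulr0.
have [k xE] := primitive_log (class_neq0 xC); have [m ->] := primitive_log y0.
move: xC; rewrite xE -exprD !mem_class_exp // => /eqP k0.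
by rewrite -modnDml k0 mod0n add0n.
Qed.

Lemma class_one e : (e %| n)%N -> 1 \in C e 0.
Proof. by move=> en; rewrite -(expr0 g) mem_class_exp. Qed.

Lemma mem_classV e x : (e %| n)%N -> x \in C e 0 -> x^-1 \in C e 0.
Proof.
move=> en xC.
by rewrite -(mem_classM 0 x^-1 en xC) mulfV ?class_one // (class_neq0 xC).
Qed.

Lemma class_shift e i x : (e %| n)%N -> (g ^+ i * x \in C e i) = (x \in C e 0).
Proof.
move=> en; have [->|x0] := eqVneq x 0.
  by rewrite mulr0 !(negbTE (class0 _ _)).
have [m ->] := primitive_log x0; rewrite -exprD !mem_class_exp //.
by rewrite -{2}[i]addn0 eqn_modDl.
Qed.

Lemma class_subset d e : (e %| n)%N -> (d %| e)%N -> C e 0 \subset C d 0.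
Proof.
move=> en de; apply/subsetP=> x xC.
have [m xE] := primitive_log (class_neq0 xC); move: xC; rewrite xE.
rewrite !mem_class_exp ?(dvdn_trans de en) // !mod0n.
exact: dvdn_trans.
Qed.

Lemma class_disjoint e (i j : 'I_e) : (e %| n)%N -> i != j ->
  [disjoint C e i & C e j].
Proof.
move=> en ij; apply/pred0P=> x /=; apply: contraNF ij => /andP[xi].
have [m xE] := primitive_log (class_neq0 xi); move: xi.
by rewrite xE !mem_class_exp // => /eqP->; rewrite !modn_small.
Qed.

(** For [x = g ^+ m], the equation says that [n] divides [m * d], that is, [n %/ d] divides [m].
    With [d = q.-1] this places the nonzero elements of GF(q) in a class. *)
Lemma unity_root_class d x : (d %| n)%N ->
  (x ^+ d == 1) = (x \in C (n %/ d) 0).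
Proof.
move=> dn; have n0 : (0 < n)%N by rewrite -order_primitive order_gt0.
have d0 : (0 < d)%N by rewrite (dvdn_gt0 n0).
have [->|x0] := eqVneq x 0.
  by rewrite expr0n gtn_eqF //= eq_sym oner_eq0 (negbTE (class0 _ _)).
have [m ->] := primitive_log x0.
rewrite mem_class_exp ?dvdn_div // -exprM -(expr0 g) eq_primitive_exp !mod0n.
by rewrite -/(n %| _)%N -/(n %/ d %| m)%N -{1}(divnK dn) dvdn_pmul2r.
Qed.

Lemma card_unity_roots d : (d %| n)%N -> #|[set x : F | x ^+ d == 1]| = d.
Proof.
move=> dn; have n0 : (0 < n)%N by rewrite -order_primitive order_gt0.
rewrite (_ : [set _ | _] = C (n %/ d) 0); last first.
  by apply/setP=> x; rewrite inE unity_root_class.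
by rewrite card_class ?dvdn_div // divnA // mulKn.
Qed.

(** The [d]-th power map sends the nonzero elements onto [C d 0], and each fibre is a coset of the
    group of [d]-th roots of unity, which has [d] elements. *)
Lemma sum_power (V : zmodType) (f : F -> V) d : (d %| n)%N ->
  \sum_(x | x != 0) f (x ^+ d) = (\sum_(v in C d 0) f v) *+ d.
Proof.
move=> dn; have d0 : (0 < d)%N.
  by rewrite (dvdn_gt0 _ dn) // -order_primitive order_gt0.
rewrite -sumrMnl.
rewrite (partition_big (fun x => x ^+ d) (mem (C d 0))) /=; last first.
  move=> x x0; have [m ->] := primitive_log x0.
  by rewrite -exprM mem_class_exp // modnMl mod0n.
apply: eq_bigr => v vC; have [m vE] := primitive_log (class_neq0 vC).
move: vC; rewrite vE mem_class_exp // mod0n => /dvdnP[k mE].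
rewrite (eq_bigr (fun=> f (g ^+ m))); last by move=> x /andP[_ /eqP->].
rewrite sumr_const; congr (_ *+ _).
have gk0 : g ^+ k != 0 by rewrite expf_neq0 // primitive_neq0.
rewrite -[RHS](card_unity_roots dn) -[RHS](card_imset _ (mulfI gk0)).
apply: eq_card => x.
rewrite unfold_in /=; apply/andP/imsetP => [[x0 /eqP xd]|[y]]; last first.
  rewrite inE => /eqP y1 ->; have y0 : y != 0.
    by apply: contra_eq_neq y1 => ->; rewrite expr0n gtn_eqF // eq_sym oner_eq0.
  by rewrite mulf_neq0 // exprMn y1 mulr1 -exprM mE.
exists (x / g ^+ k); last by rewrite mulrC divfK.
by rewrite inE expr_div_n xd mE exprM divff // -exprM expf_neq0 // primitive_neq0.
Qed.

(* Since [alpha ^ (2m) = 1], [(q - 1)(q + 1)] divides [2m]; if [q] is odd one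
   factor 2 is absorbed by either [q - 1] or [q + 1], and if [q] is even
   [q ^ 2 - 1] is odd. *)
Lemma log_opp1 q m : ((q.-1 * q.+1) %| n)%N -> (odd q = odd #|F|) ->
  g ^+ m = -1 -> (q.-1 %| m)%N /\ (q.+1 %| m)%N.
Proof.
move=> qn oddq gm.
have n0 : (0 < n)%N by rewrite -order_primitive order_gt0.
have n2m : (n %| m.*2)%N.
  rewrite -muln2 /dvdn -[X in _ == X](mod0n n) -eq_primitive_exp exprM gm expr0.
  by rewrite sqrrN expr1n.
have [q_odd|q_even] := boolP (odd q).
  have := dvdn_trans qn n2m; rewrite -muln2.
  have [h qE] : exists h, q = h.*2.+1.
    by exists q./2; rewrite -{1}(odd_double_half q) q_odd.
  rewrite qE /=; rewrite (_ : h.*2.+2 = (h.+1 * 2)%N) ?muln2 //.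
  rewrite -!muln2 => qm; split.
    apply: dvdn_trans (_ : (h * 2 * h.+1 %| m)%N); first exact: dvdn_mulr.
    by rewrite -(@dvdn_pmul2r 2) // -mulnA.
  apply: dvdn_trans (_ : (h.+1 * 2 * h %| m)%N); first exact: dvdn_mulr.
  by rewrite -(@dvdn_pmul2r 2) // -mulnA [(_ * (h * 2))%N]mulnC.
have n_m : (n %| m)%N.
  rewrite -muln2 Gauss_dvdl // in n2m; rewrite coprimen2.
  by rewrite oddq in q_even; case: (#|F|) n0 q_even => //= k _; rewrite negbK.
by split; apply: dvdn_trans n_m; apply: dvdn_trans qn;
   [apply: dvdn_mulr | apply: dvdn_mull].
Qed.

End CyclotomicClasses.

(** Modulo [q + 1], [- q] is 1, hence so are its powers. *)
Lemma dvdz_expN1 (q m : nat) : (q.+1%:Z %| (- q%:Z) ^+ m - 1)%Z.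
Proof.
by rewrite -(expr1n _ m) subrXX dvdz_mulr //; apply/dvdzP; exists (-1); lia.
Qed.

(** The irreducible characters of the abelian group (F, +) are linear and their kernels meet
    trivially, so one of them differs from 1 at the element 1. Integrality of the values serves
    later to pass from rational sums to integers. *)
Lemma additive_character_exists (F : finFieldType) :
  exists psi : F -> algC,
    [/\ psi 0 = 1, {morph psi : x y / x + y >-> x * y}, exists z, psi z != 1,
        forall x, psi (- x) = (psi x)^* & forall x, psi x \in Aint].
Proof.
pose G := [set: F]%G.
have linG i : 'chi[G]_i \is a linear_char.
  by apply/char_abelianP; apply: FinRing.zmod_abelian.
have [i /= i1] : exists i, (1 : F) \notin cfker 'chi[G]_i.
  apply/existsP; rewrite -negb_forall; apply/negP=> /forallP all1.
  have : (1 : F) \in \bigcap_i cfker 'chi[G]_i by apply/bigcapP=> i _; apply: all1.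
  by rewrite TI_cfker_irr inE => /eqP/eqP; rewrite oner_eq0.
exists 'chi_i; split=> [|x y||x|x].
- exact: (lin_char1 (linG i)).
- by apply: (lin_charM (linG i)); rewrite inE.
- by exists 1; rewrite cfkerEirr inE (lin_char1 (linG i)) in i1.
- by apply: (lin_charV_conj (linG i)); rewrite inE.
- exact/Aint_char/irr_char.
Qed.

(** * Orthogonality and Fourier inversion *)

Section AdditiveCharacter.

Variables (F : finFieldType) (psi : F -> algC).
Hypothesis psi0 : psi 0 = 1.
Hypothesis psiD : {morph psi : x y / x + y >-> x * y}.
Hypothesis psi_nontrivial : exists z, psi z != 1.

(** Translating by some [z] in [V] with [f z != 1] multiplies the sum by [f z], so it vanishes. The
    subgroup [V] will be the whole field, GF(q) or [Ann]. *)
Lemma sum_additive (V : {set F}) (f : F -> algC) :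
    {in V &, forall x y, x - y \in V} -> {morph f : x y / x + y >-> x * y} ->
  \sum_(x in V) f x = if [forall x in V, f x == 1] then #|V|%:R else 0.
Proof.
move=> VB fD; case: ifPn => [/forall_inP f1|].
  by rewrite (eq_bigr (fun=> 1)) ?sumr_const // => x /f1/eqP.
rewrite negb_forall_in => /exists_inP[z zV fz1].
have V0 : 0 \in V by rewrite -(subrr z) VB.
have VD x : (z + x \in V) = (x \in V).
  apply/idP/idP=> xV; first by rewrite -(addKr z x) addrC VB.
  by rewrite -(opprK x) VB // -sub0r VB.
have : \sum_(x in V) f x = f z * \sum_(x in V) f x.
  rewrite [LHS](reindex_inj (addrI z)) mulr_sumr /=.
  by apply: eq_big => x; rewrite ?VD // fD.
move/eqP; rewrite -subr_eq0 -{1}[X in X - _]mul1r -mulrBl mulf_eq0.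
by rewrite subr_eq0 eq_sym (negbTE fz1) => /eqP.
Qed.

Lemma sum_psi c : \sum_x psi (c * x) = if c == 0 then #|F|%:R else 0.
Proof.
have := @sum_additive [set: F] (fun x => psi (c * x)).
under eq_bigl do rewrite inE; rewrite cardsT => -> //; last first.
- by move=> x y; rewrite mulrDr psiD.
- by move=> x y _ _; rewrite inE.
have [->|c0] := eqVneq c 0.
  by case: ifPn => // /negP[]; apply/forall_inP=> x _; rewrite mul0r psi0.
case: ifPn => // /forall_inP c1; case: psi_nontrivial => z /eqP[].
by have := c1 (c^-1 * z); rewrite inE mulVKf // => /(_ isT)/eqP.
Qed.

Definition fourier (A : {set F}) (c : F) : algC := \sum_(x in A) psi (c * x).

Lemma fourier_inversion A z :
  \sum_c psi (- (c * z)) * fourier A c = #|F|%:R * (z \in A)%:R.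
Proof.
under eq_bigr => c _ do rewrite mulr_sumr.
rewrite exchange_big /= (eq_bigr (fun x => #|F|%:R * (x == z)%:R)); last first.
  move=> x _; rewrite (eq_bigr (fun c => psi ((x - z) * c))) => [|c _].
    by rewrite sum_psi subr_eq0; case: eqP => _; rewrite ?mulr1 ?mulr0.
  by rewrite -psiD mulrBl addrC ![_ * c]mulrC.
rewrite -mulr_sumr; congr (_ * _); rewrite big_mkcond (bigD1 z) //= big1.
  by rewrite addr0 eqxx; case: (z \in A).
by move=> x /negbTE->; case: ifP.
Qed.

(** Expanding both transforms gives terms [psi ((x - y - z) * c)]; summing over [c] first keeps
    exactly the pairs with [x - y = z]. *)
Lemma fourier_diff_count A B z :
  \sum_c psi (- (c * z)) * (fourier A c * fourier B (- c)) =
    #|F|%:R * (diff_count A B z)%:R.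
Proof.
under eq_bigr => c _ do rewrite mulr_suml mulr_sumr.
rewrite exchange_big natr_sum mulr_sumr /=; apply: eq_bigr => x _.
under eq_bigr => c _ do rewrite !mulr_sumr.
rewrite exchange_big natr_sum mulr_sumr /=; apply: eq_bigr => y _.
rewrite (eq_bigr (fun c => psi ((x - y - z) * c))) => [|c _].
  by rewrite sum_psi subr_eq0; case: eqP => _; rewrite ?mulr1 ?mulr0.
by rewrite -!psiD; congr psi; ring.
Qed.

(** * The subfield GF(q) and the annihilator line *)

Section HermitianSums.

Variables (alpha : {unit F}) (p a q beta : nat).
Hypothesis alpha_prim : primitive_element alpha.
Hypotheses (p_prime : prime p) (a_gt0 : (0 < a)%N) (q_def : q = (p ^ a)%N).
Hypotheses (beta_gt0 : (0 < beta)%N) (cardF : #|F| = (q ^ (2 * beta))%N).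
Hypothesis psi_conj : forall x, psi (- x) = (psi x)^*.
Hypothesis psi_Aint : forall x, psi x \in Aint.

Local Notation n := (#|F|.-1).
Local Notation g := (val alpha).
Local Notation C := (cyclotomic_class alpha).

Lemma q_gt1 : (1 < q)%N.
Proof.
by rewrite q_def -(exp1n a) ltn_exp2r // prime_gt1.
Qed.

Lemma q_sqr_dvd : (q.-1 * q.+1 %| n)%N.
Proof.
have -> : (q.-1 * q.+1)%N = (q ^ 2).-1 by have := q_gt1; nia.
by rewrite cardF expnM !predn_exp dvdn_mulr.
Qed.

Lemma odd_card : odd q = odd #|F|.
Proof. by rewrite cardF oddX muln_eq0 /= gtn_eqF. Qed.

Lemma q1_dvd : (q.-1 %| n)%N.
Proof. exact: dvdn_trans (dvdn_mulr _ (dvdnn _)) q_sqr_dvd. Qed.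

Lemma qS_dvd : (q.+1 %| n)%N.
Proof. exact: dvdn_trans (dvdn_mull _ (dvdnn _)) q_sqr_dvd. Qed.

Lemma frobD : {morph (fun x : F => x ^+ q) : x y / x + y}.
Proof.
have pF : p \in [pchar F]%R.
  by apply: (@card_finPcharP F p (a * (2 * beta))); rewrite // expnM -q_def.
move=> x y; apply: exprDn_pchar; rewrite q_def pnatX; apply/orP; left.
by rewrite pnatE.
Qed.

(** The logarithm of -1 is divisible by [q + 1], hence by [e], so -1 lies in [C e 0]. *)
Lemma class_opp e i : (e %| q.+1)%N -> forall x, (- x \in C e i) = (x \in C e i).
Proof.
move=> eq x; rewrite -mulN1r; have en := dvdn_trans eq qS_dvd.
apply: mem_classM => //; have [m mE] : exists m, -1 = g ^+ m :> F.
  by apply: primitive_log; rewrite // oppr_eq0 oner_eq0.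
have [_ qm] := log_opp1 alpha_prim q_sqr_dvd odd_card (esym mE).
by rewrite mE mem_class_exp // mod0n; apply: dvdn_trans eq qm.
Qed.

(** The subfield GF(q), as the fixed points of the Frobenius power. *)
Definition Fq : {set F} := [set x | x ^+ q == x].

Lemma FqE x : (x \in Fq) = (x == 0) || (x ^+ q.-1 == 1).
Proof.
rewrite inE -[in LHS](prednK (ltnW q_gt1)) exprS -subr_eq0.
by rewrite -[X in _ - X]mulr1 -mulrBr mulf_eq0 subr_eq0.
Qed.

Lemma card_Fq : #|Fq| = q.
Proof.
have -> : Fq = 0 |: [set x | x ^+ q.-1 == 1].
  by apply/setP=> x; rewrite FqE !inE.
rewrite cardsU1 (card_unity_roots alpha_prim q1_dvd) inE expr0n.
have := q_gt1; case: (q) => [|[|k]] //= _.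
by rewrite eq_sym oner_eq0.
Qed.

Lemma FqB : {in Fq &, forall x y, x - y \in Fq}.
Proof.
move=> x y; rewrite !inE => /eqP xq /eqP yq; rewrite frobD xq.
have : (y + - y) ^+ q = 0 by rewrite subrr expr0n gtn_eqF // ltnW // q_gt1.
by rewrite frobD yq => /eqP; rewrite addr_eq0 eq_sym eqr_oppLR => /eqP->.
Qed.

(** The nonzero elements of GF(q) form the subgroup [C (n %/ q.-1) 0], and [q.+1] divides
    [n %/ q.-1] because [q.-1 * q.+1] divides [n]. *)
Lemma Fq_class x : x \in Fq -> x != 0 -> x \in C q.+1 0.
Proof.
rewrite FqE => /orP[->//|]; rewrite (unity_root_class alpha_prim) ?q1_dvd //.
move=> xC _; apply: (subsetP (class_subset alpha_prim _ _)) xC.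
  exact: dvdn_div q1_dvd.
rewrite -(@dvdn_pmul2l q.-1); last by have := q_gt1; lia.
by rewrite [(q.-1 * (_ %/ _))%N]mulnC divnK ?q1_dvd ?q_sqr_dvd.
Qed.

(** The orthogonal of the image of a GF(q)-linear map under the pairing [psi (b * v)]; it arises
    when the Hermitian exponent is linearised. *)
Definition Ann : {set F} := [set b | [forall w, psi (b * (w ^+ q + w)) == 1]].

Lemma AnnP b : reflect (forall w, psi (b * (w ^+ q + w)) = 1) (b \in Ann).
Proof. by rewrite inE; apply: (iffP forallP) => H w; apply/eqP/H. Qed.

Lemma psiB x y : psi x = 1 -> psi y = 1 -> psi (x - y) = 1.
Proof. by move=> x1 y1; rewrite psiD psi_conj x1 y1 rmorph1 mulr1. Qed.

Lemma AnnB : {in Ann &, forall x y, x - y \in Ann}.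
Proof.
move=> x y /AnnP x1 /AnnP y1; apply/AnnP=> w; rewrite mulrBl.
exact: psiB.
Qed.

Lemma Ann_scale l b : l \in Fq -> b \in Ann -> l * b \in Ann.
Proof.
rewrite inE => /eqP lq /AnnP b1; apply/AnnP=> w.
have <- := b1 (l * w); congr psi; rewrite exprMn lq; ring.
Qed.

Lemma sum_psi_Ann b :
  \sum_w psi (b * (w ^+ q + w)) = if b \in Ann then #|F|%:R else 0.
Proof.
have := @sum_additive [set: F] (fun w => psi (b * (w ^+ q + w))).
under eq_bigl do rewrite inE; rewrite cardsT => ->; first last.
- by move=> x y; rewrite frobD -psiD; congr psi; ring.
- by move=> x y _ _; rewrite inE.
rewrite [in RHS]inE; congr (if _ then _ else _).
by apply: eq_forallb => w; rewrite inE.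
Qed.

(** Since [q.-1] divides the logarithm of -1, some [g ^+ k] has [q.-1]-th power -1; multiplication
    by it carries [Fq] onto the kernel. *)
Lemma card_kernel : #|[set w : F | w ^+ q + w == 0]| = q.
Proof.
have [m mE] : exists m, -1 = g ^+ m :> F.
  by apply: primitive_log; rewrite // oppr_eq0 oner_eq0.
have [/dvdnP[k kE] _] := log_opp1 alpha_prim q_sqr_dvd odd_card (esym mE).
have gk0 : g ^+ k != 0 by rewrite expf_neq0 // primitive_neq0.
have gkq : (g ^+ k) ^+ q = - g ^+ k.
  rewrite -[q in LHS](prednK (ltnW q_gt1)) exprSr -exprM -kE -mE.
  by rewrite mulN1r.
rewrite -[RHS]card_Fq -[RHS](card_imset _ (mulfI gk0)); apply: eq_card => w.
rewrite inE; apply/eqP/imsetP => [wq|[x]]; last first.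
  by rewrite inE => /eqP xq ->; rewrite exprMn gkq xq mulNr addNr.
exists (w / g ^+ k); last by rewrite mulrC divfK.
move/eqP: wq; rewrite addr_eq0 => /eqP wq.
by rewrite inE expr_div_n wq gkq invrN mulrNN.
Qed.

(* Double counting of [sum_b sum_w psi (b (w ^ q + w))]. *)
Lemma card_Ann : #|Ann| = q.
Proof.
have F0 : #|F|%:R != 0 :> algC by rewrite pnatr_eq0 -lt0n cardF expn_gt0 ltnW ?q_gt1.
apply/eqP; rewrite -(eqr_nat algC) -(inj_eq (mulIf F0)); apply/eqP.
transitivity (\sum_b \sum_w psi (b * (w ^+ q + w))).
  under [RHS]eq_bigr do rewrite sum_psi_Ann.
  by rewrite -big_mkcond sumr_const mulr_natl.
rewrite exchange_big /=; under eq_bigr => w _.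
  by under eq_bigr do rewrite mulrC; rewrite sum_psi; over.
rewrite -big_mkcond sumr_const mulr_natl; congr (_ *+ _).
by rewrite -[RHS]card_kernel; apply: eq_card => w; rewrite inE.
Qed.

(** Scaling keeps the line through [b0] inside [Ann], and both have [q] elements. *)
Lemma Ann_line b0 : b0 \in Ann -> b0 != 0 -> Ann = [set l * b0 | l in Fq].
Proof.
move=> b0A b00; apply/esym/eqP; rewrite eqEcard card_Ann card_imset; last first.
  exact: mulIf.
rewrite card_Fq leqnn andbT; apply/subsetP=> _ /imsetP[l lF ->].
exact: Ann_scale.
Qed.

(** * Values of the Hermitian sums *)

Definition hermitian_sum (c : F) : algC := \sum_x psi (c * x ^+ q.+1).

Lemma hermitian_sum_class c : hermitian_sum c = 1 + (fourier (C q.+1 0) c) *+ q.+1.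
Proof.
rewrite /hermitian_sum (bigD1 0) //= expr0n mulr0 psi0.
by rewrite (sum_power alpha_prim (fun v => psi (c * v)) qS_dvd).
Qed.

(* Substituting [x = y + t], and then [y = t w], linearises the exponent. *)
Lemma hermitian_sum_norm c :
  hermitian_sum c * (hermitian_sum c)^* =
    #|F|%:R * \sum_(t | c * t ^+ q.+1 \in Ann) psi (c * t ^+ q.+1).
Proof.
rewrite /hermitian_sum rmorph_sum mulr_sumr /=.
rewrite (eq_bigr (fun y => \sum_t psi (c * t ^+ q.+1) *
    psi (c * (y ^+ q * t + y * t ^+ q)))); last first.
  move=> y _; rewrite mulr_suml (reindex_inj (addrI y)) /=.
  apply: eq_bigr => t _; rewrite -psi_conj -!psiD; congr psi.
  rewrite !exprS frobD; ring.
rewrite exchange_big mulr_sumr [RHS]big_mkcond /=; apply: eq_bigr => t _.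
rewrite -mulr_sumr.
have [->|t0] := eqVneq t 0.
  rewrite expr0n mulr0 psi0 mul1r.
  have -> : 0 \in Ann by apply/AnnP=> w; rewrite mul0r.
  rewrite (eq_bigr (fun=> 1)) ?sumr_const ?mulr1 // => y _.
  by rewrite mulr0 expr0n gtn_eqF ?mulr0 ?addr0 ?mulr0 ?psi0 // ltnW ?q_gt1.
rewrite (reindex_inj (mulfI t0)) /=.
rewrite (eq_bigr (fun w => psi (c * t ^+ q.+1 * (w ^+ q + w)))); last first.
  by move=> w _; congr psi; rewrite exprMn exprS; ring.
by rewrite sum_psi_Ann; case: ifP => _; rewrite ?mulr0 // mulrC.
Qed.

Lemma sum_psi_Fq x :
  \sum_(l in Fq) psi (l * x) = q%:R \/ \sum_(l in Fq) psi (l * x) = 0.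
Proof.
rewrite (sum_additive FqB) => [|y z]; last by rewrite mulrDl psiD.
by rewrite card_Fq; case: ifP => _; [left | right].
Qed.

(** Scaling by nonzero elements of GF(q) preserves [C q.+1 0], so [q.-1] times the transform is a
    sum of terms each equal to [q - 1] or -1. The transform is thus rational, and it is an algebraic
    integer. *)
Lemma fourier_int c : fourier (C q.+1 0) c \in Num.int.
Proof.
apply: Cint_rat_Aint; last by apply: rpred_sum => x _; apply: psi_Aint.
have q1_neq0 : q.-1%:R != 0 :> algC by rewrite pnatr_eq0; have := q_gt1; lia.
rewrite -[X in X \in _](mulKf q1_neq0); apply: rpredM.
  by rewrite rpredV rpred_nat.
suff -> : q.-1%:R * fourier (C q.+1 0) c =
    \sum_(v in C q.+1 0) \sum_(l in Fq :\ 0) psi (l * (c * v)).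
  apply: rpred_sum => v _.
  have := sum_psi_Fq (c * v); rewrite (big_setD1 0) /=; last first.
    by rewrite FqE eqxx.
  rewrite mul0r psi0 => -[] /(canRL (addKr _)) ->; last by rewrite addr0 rpredN1.
  by rewrite rpredD ?rpredN1 ?rpred_nat.
rewrite exchange_big /= (eq_bigr (fun=> fourier (C q.+1 0) c)) => [|l].
  rewrite sumr_const mulr_natl; congr (_ *+ _).
  by have := cardsD1 0 Fq; rewrite card_Fq FqE eqxx /= => ->.
rewrite in_setD1 => /andP[l0 lF].
rewrite /fourier [RHS](reindex_inj (mulfI l0)) /=.
apply: eq_big => [x|x _]; last by congr psi; ring.
by rewrite (mem_classM alpha_prim _ _ qS_dvd) // Fq_class.
Qed.

Local Notation s := ((- q%:Z) ^+ beta).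

(* Both [1 + x (q + 1)] and [(-q)^m] are 1 modulo [q + 1 > 2], which fixes the
   sign of the square root. *)
Lemma signed_sqrt (x : int) m :
  (1 + x * q.+1%:Z) ^+ 2 = q%:Z ^+ (2 * m) -> 1 + x * q.+1%:Z = (- q%:Z) ^+ m.
Proof.
have -> : q%:Z ^+ (2 * m) = ((- q%:Z) ^+ m) ^+ 2.
  by rewrite mulnC exprM -!exprM mulnC !exprM sqrrN.
move/eqP; rewrite eqf_sqr => /orP[/eqP//|/eqP xE].
have /dvdzP[k kE] := dvdz_expN1 q m.
have : (x + k) * q.+1%:Z = -2 by rewrite mulrDl -kE; lia.
have q1 := q_gt1; have [xk|xk] := lerP 0 (x + k); nia.
Qed.

Lemma card_sqr : #|F|%:R = s%:~R ^+ 2 :> algC.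
Proof. by rewrite cardF natrX -[RHS]rmorphXn /= exprAC sqrrN -exprM rmorphXn. Qed.

Lemma Ann_nonzero : exists2 b0, b0 \in Ann & b0 != 0.
Proof.
have : (0 < #|Ann :\ (0 : F)%R|)%N.
  have := cardsD1 (0 : F) Ann; rewrite card_Ann; have := q_gt1.
  by case: ((0 : F) \in _); lia.
by case/card_gt0P=> b; rewrite in_setD1 => /andP[b0 bA]; exists b.
Qed.

Variable b0 : F.
Hypotheses (b0_Ann : b0 \in Ann) (b0_neq0 : b0 != 0).

Lemma Ann_class b : b \in Ann -> b != 0 -> b / b0 \in C q.+1 0.
Proof.
rewrite (Ann_line b0_Ann b0_neq0) => /imsetP[l lF ->].
by rewrite mulf_eq0 negb_or mulfK // => /andP[l0 _]; apply: Fq_class.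
Qed.

(** All nonzero elements of [Ann] lie in the coset of [b0] modulo [C q.+1 0]; the products [c * v]
    run over the coset of [c], which is either the same or disjoint. *)
Lemma sum_psi_Ann_class c : c != 0 ->
  \sum_(v in C q.+1 0 | c * v \in Ann) psi (c * v) =
    if c / b0 \in C q.+1 0 then \sum_(b in Ann) psi b - 1 else 0.
Proof.
move=> c0; have qn := qS_dvd; case: ifPn => cC; last first.
  rewrite big1 // => v /andP[vC cvA]; case/negP: cC.
  rewrite -(mem_classM alpha_prim _ _ qn vC) mulrA [v * c]mulrC Ann_class //.
  by rewrite mulf_neq0 // (class_neq0 vC).
have A0 : 0 \in Ann by apply/AnnP=> w; rewrite mul0r.
rewrite [X in _ = X - 1](bigD1 0) //= psi0 [1 + _]addrC addrK.
rewrite [LHS](reindex_inj (mulfI (invr_neq0 c0))) /=.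
apply: eq_big => [b|b _]; rewrite mulVKf // andbC.
have [bA|//] := boolP (b \in Ann); rewrite /=.
have [->|b_neq0] := eqVneq b 0; first by rewrite mulr0 (negbTE (class0 _ _ _)).
rewrite -(mem_classM alpha_prim _ _ qn cC).
have -> : c / b0 * (c^-1 * b) = b / b0 by field; rewrite b0_neq0 c0.
exact: Ann_class.
Qed.

Lemma hermitian_sumE c : c != 0 ->
  hermitian_sum c =
    ((- q%:Z) ^+ (if c / b0 \in C q.+1 0 then beta.+1 else beta))%:~R.
Proof.
move=> c0; have [x xE] := intrP (fourier_int c).
have hE : hermitian_sum c = (1 + x * q.+1%:Z)%:~R.
  by rewrite hermitian_sum_class xE -mulr_natr rmorphD rmorphM.
rewrite hE; congr (_%:~R); apply: signed_sqrt.
(* The sum is an integer, so its squared modulus is its square. On the other side [t = 0]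
   contributes 1, and the nonzero [t] reach each element of [C q.+1 0] exactly [q.+1] times. *)
have := hermitian_sum_norm c; rewrite hE rmorph_int -rmorphM -expr2.
rewrite (bigD1 0) /=; last by rewrite expr0n mulr0; apply/AnnP=> w; rewrite mul0r.
rewrite expr0n mulr0 psi0 (eq_bigl (fun t => (t != 0) && (c * t ^+ q.+1 \in Ann)));
  last by move=> t; rewrite andbC.
rewrite big_mkcondr /= (sum_power alpha_prim
  (fun v => if c * v \in Ann then psi (c * v) else 0) qS_dvd).
rewrite -big_mkcondr sum_psi_Ann_class //.
have -> : #|F|%:R = (q%:Z ^+ (2 * beta))%:~R :> algC.
  by rewrite cardF natrX rmorphXn.
case: ifP => cC; last by rewrite mul0rn addr0 mulr1; apply: intr_inj.
rewrite (sum_additive AnnB) // card_Ann; case: ifP => _.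
  have -> : 1 + (q%:R - 1) *+ q.+1 = (q%:Z ^+ 2)%:~R :> algC.
    by rewrite rmorphXn /= -mulr_natr -natr1; ring.
  by rewrite -rmorphM -exprD mulnS addnC; apply: intr_inj.
(* If [psi] were nontrivial on [Ann], the square of an integer would be [- q] times a power of [q],
   which is negative. *)
have -> : 1 + (0 - 1) *+ q.+1 = (- q%:Z)%:~R :> algC.
  by rewrite rmorphN /= -mulr_natr -natr1; ring.
rewrite -rmorphM => /intr_inj E.
have := sqr_ge0 (1 + x * q.+1%:Z); rewrite E mulrN oppr_ge0 leNgt.
by rewrite mulr_gt0 ?exprn_gt0 // ltz_nat ltnW ?q_gt1.
Qed.


(** * Fourier transforms of the classes of order [e] *)

Lemma fourier_class0 e (h : int) c : (e %| q.+1)%N -> s = e%:Z * h + 1 -> c != 0 ->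
  fourier (C e 0) c = h%:~R - s%:~R * (c / b0 \in C e 0)%:R.
Proof.
move=> eq sE c0; have qn := qS_dvd; have en := dvdn_trans eq qn.
have n0 : (0 < n)%N by rewrite -(order_primitive alpha_prim) order_gt0.
have q1 := q_gt1.
pose m := #|C q.+1 0|.
have mE : (m * q.+1 = n)%N by rewrite /m card_class // divnK.
(* The two values [s] and [- q * s] of the Hermitian sum differ by [q.+1 * s], which gives one
   formula for both. *)
have fN x : x != 0 -> fourier (C q.+1 0) x * q.+1%:R =
    (s - 1)%:~R - q.+1%:R * s%:~R * (x / b0 \in C q.+1 0)%:R.
  move=> x0; have := hermitian_sum_class x; rewrite hermitian_sumE // mulr_natr.
  move=> /esym/(canRL (addKr _)) ->; case: ifP => _.
    by rewrite exprS !rmorphM rmorphN rmorphB /= -natr1; ring.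
  by rewrite rmorphB /=; ring.
(* Multiplication by any [y] in [C q.+1 0] permutes [C e 0]. *)
have avg : m%:R * fourier (C e 0) c = \sum_(z in C e 0) fourier (C q.+1 0) (c * z).
  rewrite exchange_big mulr_natl -sumr_const /=; apply: eq_bigr => y yC.
  have yCe : y \in C e 0 by apply: (subsetP (class_subset alpha_prim qn eq)).
  rewrite /fourier (reindex_inj (mulfI (class_neq0 yC))) /=.
  apply: eq_big => [z|z _]; first by rewrite (mem_classM alpha_prim).
  by congr psi; ring.
(* With [z = b0 / c * w] and [w] in [C q.+1 0], the element [z] lies in [C e 0] for every such [w]
   or for none, according to [c / b0]. *)
have cnt : \sum_(z in C e 0) (c * z / b0 \in C q.+1 0)%:R =
    m%:R * (c / b0 \in C e 0)%:R :> algC.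
  have cb0 : b0 / c != 0 by rewrite mulf_neq0 ?invr_neq0.
  rewrite (reindex_inj (mulfI cb0)) /= big_mkcond mulr_natl /m.
  rewrite -sumr_const [RHS]big_mkcond /=; apply: eq_bigr => w _.
  have -> : c * (b0 / c * w) / b0 = w by field; rewrite c0 b0_neq0.
  have [wC|] := boolP (w \in C q.+1 0); last by rewrite if_same.
  have wCe : w \in C e 0 by apply: (subsetP (class_subset alpha_prim qn eq)).
  rewrite mulrC (mem_classM alpha_prim) // -(invf_div c b0).
  suff -> : ((c / b0)^-1 \in C e 0) = (c / b0 \in C e 0) by case: (_ \in _).
  by apply/idP/idP=> /(mem_classV alpha_prim en); rewrite ?invrK.
have mq0 : m%:R * q.+1%:R != 0 :> algC by rewrite -natrM mE pnatr_eq0 -lt0n.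
apply: (mulfI mq0); rewrite mulrAC avg mulr_suml.
rewrite (eq_bigr (fun z => (s - 1)%:~R - q.+1%:R * s%:~R *
    (c * z / b0 \in C q.+1 0)%:R)); last first.
  by move=> z zC; rewrite fN // mulf_neq0 // (class_neq0 zC).
rewrite sumrB sumr_const -mulr_sumr cnt card_class //.
have -> : (s - 1)%:~R *+ (n %/ e) = m%:R * q.+1%:R * h%:~R :> algC.
  rewrite -natrM mE -[in RHS](divnK en) natrM sE addrK rmorphM /=.
  by rewrite -mulr_natr; ring.
by ring.
Qed.

Lemma fourier_class e (h : int) i c : (e %| q.+1)%N -> s = e%:Z * h + 1 -> c != 0 ->
  fourier (C e i) c = h%:~R - s%:~R * (c * g ^+ i / b0 \in C e 0)%:R.
Proof.
move=> eq sE c0; have en := dvdn_trans eq qS_dvd.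
have gi0 : g ^+ i != 0 by rewrite expf_neq0 // primitive_neq0.
rewrite -(fourier_class0 eq sE) ?mulf_neq0 //.
rewrite /fourier (reindex_inj (mulfI gi0)) /=; apply: eq_big => [x|x _].
  exact: class_shift.
by rewrite mulrA.
Qed.

(** Away from 0 a transform takes only the values [h] and [h - s], and for distinct classes [h - s]
    never occurs at the same [c]. Products therefore become linear in the transforms, ready for
    inversion; the last term corrects the value at [c = 0]. *)
Lemma fourier_classM e (h : int) (i j : 'I_e) c :
    (e %| q.+1)%N -> s = e%:Z * h + 1 ->
  fourier (C e i) c * fourier (C e j) c =
    h%:~R * (fourier (C e i) c + fourier (C e j) c) - h%:~R ^+ 2
    + (i == j)%:R * s%:~R * (h%:~R - fourier (C e i) c)
    + (c == 0)%:R * s%:~R ^+ 2 * (h%:~R ^+ 2 + (i == j)%:R * h%:~R).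
Proof.
move=> eq sE; have en := dvdn_trans eq qS_dvd.
have n0 : (0 < n)%N by rewrite -(order_primitive alpha_prim) order_gt0.
have [->|c0] := eqVneq c 0.
  (* At 0 the transform is the class size, [(s ^+ 2 - 1) / e], and [s - 1 = e * h]. *)
  have f0 l : fourier (C e l) 0 = h%:~R * (1 + s%:~R).
    rewrite /fourier (eq_bigr (fun=> 1)); last by move=> x _; rewrite mul0r psi0.
    have e0 : e%:R != 0 :> algC by rewrite pnatr_eq0 -lt0n (dvdn_gt0 n0).
    rewrite sumr_const card_class //; apply: (mulfI e0).
    rewrite -natrM mulnC divnK // -subn1 natrB; last first.
      by rewrite cardF expn_gt0 ltnW ?q_gt1.
    by rewrite card_sqr sE rmorphD rmorphM /=; ring.
  by rewrite !f0; case: (i == j); rewrite ?mulr1n ?mulr0n; ring.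
rewrite !(fourier_class _ eq sE c0); case: eqVneq => [<-|ij].
  by case: (_ \in _); rewrite ?mulr1n ?mulr0n; ring.
have : ~~ ((c * g ^+ i / b0 \in C e 0) && (c * g ^+ j / b0 \in C e 0)).
  apply: contra ij; have [m mE] : exists m, c / b0 = g ^+ m.
    by apply: primitive_log; rewrite // mulf_neq0 ?invr_neq0.
  rewrite ![c * _ / b0]mulrAC mE -!exprD !mem_class_exp // => /andP[/eqP<-].
  by rewrite eq_sym eqn_modDl !modn_small.
by case: (_ \in _); case: (_ \in _) => //= _; rewrite ?mulr1n ?mulr0n; ring.
Qed.

(** Inversion applies to the linearised product term by term: constants sum to 0 since [z != 0], and
    the correction at [c = 0] carries the factor [s ^+ 2], which is the field order and cancels the
    normalisation. *)
Lemma cyclotomic_numbers_aux e (h : int) (i j : 'I_e) z :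
    (e %| q.+1)%N -> s = e%:Z * h + 1 -> z != 0 ->
  (diff_count (C e i) (C e j) z)%:Z =
    h ^+ 2 + h * ((z \in C e i)%:Z + (z \in C e j)%:Z)
    + (i == j)%:Z * (h - s * (z \in C e i)%:Z).
Proof.
move=> eq sE z0.
have F0 : #|F|%:R != 0 :> algC.
  by rewrite pnatr_eq0 -lt0n cardF expn_gt0 ltnW ?q_gt1.
apply: (@intr_inj algC); apply: (mulfI F0).
rewrite -(fourier_diff_count).
pose r : algC := h%:~R.
rewrite (eq_bigr (fun c => r * (psi (- (c * z)) * fourier (C e i) c)
   + r * (psi (- (c * z)) * fourier (C e j) c)
   + ((i == j)%:R * s%:~R * r - r ^+ 2) * psi ((- z) * c)
   - (i == j)%:R * s%:~R * (psi (- (c * z)) * fourier (C e i) c)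
   + (c == 0)%:R * s%:~R ^+ 2 * (r ^+ 2 + (i == j)%:R * r))); last first.
  move=> c _.
  (* The class is stable under negation, so its transform is even. *)
  have -> : fourier (C e j) (- c) = fourier (C e j) c.
    rewrite /fourier (reindex_inj oppr_inj) /=; apply: eq_big => [x|x _].
      exact: class_opp.
    by rewrite mulrNN.
  rewrite (fourier_classM _ _ c eq sE) mulNr [z * c]mulrC.
  have [->|c0] := eqVneq c 0; first by rewrite mul0r oppr0 psi0; ring.
  by rewrite mulr0n; ring.
rewrite !big_split /= sumrN -!mulr_sumr !fourier_inversion sum_psi oppr_eq0.
rewrite (negbTE z0) -!mulr_suml (bigD1 0) //= big1 => [|c /negbTE->//].
rewrite eqxx !rmorphD !rmorphM rmorphB !rmorphM /= -card_sqr.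
by case: (i == j); case: (_ \in _); case: (_ \in _) => /=; ring.
Qed.

End HermitianSums.

End AdditiveCharacter.

(** * From the counts to the parameters *)

Lemma mulz_eq1 (x y : int) : x * y = 1 -> (x = 1 /\ y = 1) \/ (x = -1 /\ y = -1).
Proof.
move=> xy; have : x \is a GRing.unit by apply/unitrPr; exists y.
by rewrite unfold_in /= => /orP[] /eqP xE; rewrite xE in xy *; [left|right]; lia.
Qed.

Lemma Posz_sum (T : finType) (P : pred T) (f : T -> nat) :
  (\sum_(i | P i) f i)%N%:Z = \sum_(i | P i) (f i)%:Z.
Proof. exact: (big_morph Posz PoszD). Qed.

Lemma sumz_const (T : finType) (A : {pred T}) (x : int) :
  \sum_(i in A) x = #|A|%:Z * x.
Proof. by rewrite sumr_const -mulr_natl natz. Qed.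

(** The character and [b0] are auxiliary choices: neither occurs in the resulting count. *)
Lemma cyclotomic_numbers (F : finFieldType) (alpha : {unit F})
    (p a q beta e : nat) (h : int) (i j : 'I_e) (z : F) :
    primitive_element alpha -> prime p -> (0 < a)%N -> q = (p ^ a)%N ->
    (0 < beta)%N -> #|F| = (q ^ (2 * beta))%N -> (e %| q.+1)%N ->
    (- q%:Z) ^+ beta = e%:Z * h + 1 -> z != 0 ->
  let C := cyclotomic_class alpha e in
  (diff_count (C i) (C j) z)%:Z =
    h ^+ 2 + h * ((z \in C i)%:Z + (z \in C j)%:Z)
    + (i == j)%:Z * (h - (e%:Z * h + 1) * (z \in C i)%:Z).
Proof.
move=> alpha_prim pp a0 qE b0 cF eq sE z0 C.
have [psi [psi0 psiD psi_nt psi_conj psi_Aint]] := additive_character_exists F.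
have [b bA bn0] := Ann_nonzero psi0 psiD psi_nt alpha_prim pp a0 qE b0 cF.
rewrite -sE.
exact: (cyclotomic_numbers_aux psi0 psiD psi_nt alpha_prim pp a0 qE b0 cF
  psi_conj psi_Aint bA bn0).
Qed.

Theorem theorem3p24 (F : finFieldType) (p a q beta q' : nat)
    (p_prime : prime p) (a_gt0 : (0 < a)%N) (q_def : q = (p ^ a)%N)
    (beta_gt0 : (0 < beta)%N) (q'_def : q' = (q ^ (2 * beta))%N)
    (cardF : #|F| = q')
    (alpha : {unit F}) (alpha_prim : primitive_element alpha)
    (e : nat) (e_dvd : (e %| q + 1)%N)
    (I : {set 'I_e}) (u : nat) (cardI : #|I| = u)
    (u_ge2 : (2 <= u)%N) (u_le : (u <= e - 1)%N) :
  let C := fun i : 'I_e => cyclotomic_class alpha e i in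
  let eta : int := cyclotomic_eta q beta e in
  let U : int := u%:Z in
  let E : int := e%:Z in
  let k : nat := ((q' - 1) %/ e)%N in
  let D : {set F} := \bigcup_(i in I) C i in
  let kD : nat := ((u * (q' - 1)) %/ e)%N in
  let lambdaD : int := U ^+ 2 * eta ^+ 2 + (3 * U - E) * eta - 1 in
  let muD : int := U ^+ 2 * eta ^+ 2 + U * eta in
  [/\ forall i : 'I_e,
        is_regular_PDS (C i) q' k
          (eta ^+ 2 - (E - 3) * eta - 1) (eta ^+ 2 + eta),
      is_DPDF I C q' u k
          (U * eta ^+ 2 + (U + 2 - E) * eta - 1) (U * (eta ^+ 2 + eta)) /\
      is_EPDF I C q' u k
          (U * (U - 1) * eta ^+ 2 + 2 * (U - 1) * eta)
          (U * (U - 1) * eta ^+ 2) &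
      is_regular_PDS D q' kD lambdaD muD /\
      (is_proper_PDS D q' kD lambdaD muD <->
        ~ ((eta = 1 /\ 2 * U - E = 1) \/ (eta = -1 /\ 2 * U - E = -1)))].
Proof.
have u_lt_e : (u < e)%N by lia.
have e_gt1 : (1 < e)%N by lia.
move=> C eta U E k D kD lambdaD muD.
have e_dvdS : (e %| q.+1)%N by rewrite -addn1.
have cF : #|F| = (q ^ (2 * beta))%N by rewrite cardF.
have en : (e %| #|F|.-1)%N.
  exact: dvdn_trans e_dvdS (qS_dvd p_prime a_gt0 q_def beta_gt0 cF).
(* The floor quotient is exact, since [e] divides [q + 1], which divides [(- q) ^+ beta - 1]. *)
have sE : (- q%:Z) ^+ beta = E * eta + 1.
  rewrite mulrC divzK ?subrK //.
  by apply: dvdz_trans (dvdz_expN1 q beta); rewrite dvdzE.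
have cyc i j z : z != 0 -> (diff_count (C i) (C j) z)%:Z =
    eta ^+ 2 + eta * ((z \in C i)%:Z + (z \in C j)%:Z)
    + (i == j)%:Z * (eta - (E * eta + 1) * (z \in C i)%:Z).
  exact: (cyclotomic_numbers _ _ alpha_prim p_prime a_gt0 q_def beta_gt0 cF).
have cardC i : #|C i| = k by rewrite card_class // cardF /k subn1.
have C0 i : 0 \notin C i by apply: class0.
have CN i x : (- x \in C i) = (x \in C i).
  exact: (class_opp alpha_prim p_prime a_gt0 q_def beta_gt0 cF).
have gC (i : 'I_e) : val alpha ^+ i \in C i by rewrite mem_class_exp.
have disjC (i j : 'I_e) : i != j -> [disjoint C i & C j].
  exact: class_disjoint.
have disjI : {in I &, forall i j, i != j -> [disjoint C i & C j]}.
  by move=> i j _ _; apply: disjC.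
have gnz i : val alpha ^+ i != 0 by rewrite expf_neq0 // primitive_neq0.
(* As [e > 1] there is a second class, and it lies outside [C i]. *)
have CnzN i : nonzero F :\: C i != set0.
  have [j ji] : exists j : 'I_e, j != i.
    apply/existsP; rewrite -negb_forall; apply/negP=> /forallP ei.
    have : (#|[set: 'I_e]| <= #|[set i]|)%N.
      by apply/subset_leq_card/subsetP=> j _; rewrite inE ei.
    by rewrite cardsT card_ord cards1 leqNgt e_gt1.
  apply/set0Pn; exists (val alpha ^+ j); rewrite !inE gnz andbT.
  by rewrite (disjointFr (disjC _ _ ji) (gC j)).
(* As [u < e], some class is left out of the union. *)
have DnzN : nonzero F :\: D != set0.
  have [j jI] : exists j : 'I_e, j \notin I.
    apply/existsP; rewrite -negb_forall; apply/negP=> /forallP Ie.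
    have : (#|[set: 'I_e]| <= #|I|)%N by apply/subset_leq_card/subsetP=> j _.
    by rewrite cardsT card_ord cardI leqNgt u_lt_e.
  apply/set0Pn; exists (val alpha ^+ j); rewrite !inE gnz andbT.
  apply/bigcupP=> -[i iI]; rewrite (disjointFl (disjC i j _) (gC j)) //.
  by apply: contraNneq jI => <-.
have D0 : 0 \notin D by apply/bigcupP=> -[i _]; rewrite (negbTE (C0 i)).
have Dne : D != set0.
  have /card_gt0P[i iI] : (0 < #|I|)%N by rewrite cardI ltnW.
  by apply/set0Pn; exists (val alpha ^+ i); apply/bigcupP; exists i.
have famI : disjoint_family I C q' u k.
  split=> // i _; split=> //; apply/subsetP=> x; rewrite !inE.
  exact: class_neq0.
have sumM z : \sum_(i in I) (z \in C i)%:Z = (z \in D)%:Z.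
  by rewrite /D mem_bigcup_disjoint // Posz_sum.
have sum_diag z : z != 0 -> (\sum_(i in I) diff_count (C i) (C i) z)%N%:Z =
    U * (eta ^+ 2 + eta) + (2 * eta - E * eta - 1) * (z \in D)%:Z.
  move=> z0; rewrite Posz_sum.
  rewrite (eq_bigr (fun i => (eta ^+ 2 + eta)
      + (2 * eta - E * eta - 1) * (z \in C i)%:Z)); last first.
    by move=> i _; rewrite cyc // eqxx mul1r; ring.
  rewrite big_split /= -mulr_sumr sumM.
  by rewrite (sumz_const (mem I)) cardI.
have sum_off z : z != 0 ->
    (\sum_(i in I) \sum_(j in I | i != j) diff_count (C i) (C j) z)%N%:Z =
    U * (U - 1) * eta ^+ 2 + 2 * (U - 1) * eta * (z \in D)%:Z.
  move=> z0; rewrite Posz_sum.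
  (* For fixed [i], the indicator of [C i] occurs [u - 1] times and is subtracted once when the sum
     over [j] is completed to [D], whence [U - 2]. *)
  rewrite (eq_bigr (fun i => ((U - 1) * eta ^+ 2 + eta * (z \in D)%:Z)
      + (U - 2) * eta * (z \in C i)%:Z)); last first.
    move=> i iI; rewrite Posz_sum.
    rewrite (eq_bigr (fun j => (eta ^+ 2 + eta * (z \in C i)%:Z)
      + eta * (z \in C j)%:Z)); last first.
      by move=> j /andP[_ /negbTE ij]; rewrite cyc // ij mul0r; ring.
    have sumi : \sum_(j in I | i != j) (z \in C j)%:Z =
        (z \in D)%:Z - (z \in C i)%:Z.
      rewrite -sumM [in RHS](bigD1 i iI) /= [RHS]addrC addKr.
      by apply: eq_bigl => j; rewrite eq_sym.
    have cardi : #|[pred j in I | i != j]|%:Z = U - 1.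
      have := cardsD1 i I; rewrite iI cardI => uE.
      rewrite /U uE PoszD [RHS]addrC addKr; congr Posz; apply: eq_card => j.
      by rewrite !inE andbC eq_sym.
    rewrite big_split /= -mulr_sumr sumi.
    by rewrite (sumz_const [pred j in I | i != j]) cardi; ring.
  rewrite big_split /= -mulr_sumr sumM.
  by rewrite (sumz_const (mem I)) cardI -/U; ring.
have cardD : #|D| = kD.
  rewrite -sum1_card sum_bigcup_disjoint //.
  under eq_bigr => i _ do rewrite sum1_card cardC.
  by rewrite sum_nat_const cardI /kD /k muln_divA // subn1 -cardF.
have regD : is_regular_PDS D q' kD lambdaD muD.
  split=> //; last first.
    apply: opp_imset => x; apply/bigcupP/bigcupP=> -[i iI xi]; exists i => //.
      by rewrite -CN.
    by rewrite CN.
  split=> //; apply: has_multiplicitiesP => // [|z z0]; first by rewrite DeltaE eqxx.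
  rewrite DeltaE (negbTE z0) diff_count_bigcup //.
  (* Differences within [D] are the internal and the external ones of the family, so the parameters
     of [D] are the sums of those in (ii). *)
  rewrite (eq_bigr (fun i => diff_count (C i) (C i) z +
    \sum_(j in I | i != j) diff_count (C i) (C j) z)%N); last first.
    move=> i iI; rewrite (bigD1 i iI) /=; congr (_ + _)%N.
    by apply: eq_bigl => j; rewrite eq_sym.
  rewrite big_split /= PoszD sum_diag // sum_off // /lambdaD /muD.
  by case: (z \in D) => /=; ring.
split=> [i||].
- split=> //; last exact: opp_imset.
  split=> //; apply: has_multiplicitiesP => // [||z z0].
  + by rewrite DeltaE eqxx.
  + by apply/set0Pn; exists (val alpha ^+ i).
  rewrite DeltaE (negbTE z0) cyc // eqxx.
  by case: (z \in C i) => /=; ring.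
- split; split=> //; apply: has_multiplicitiesP => // [|z z0].
  + by rewrite mset_sumE big1 // => i _; rewrite DeltaE eqxx.
  + rewrite mset_sumE (eq_bigr (fun i => diff_count (C i) (C i) z)); last first.
      by move=> i _; rewrite DeltaE (negbTE z0).
    by rewrite sum_diag // /family_union -/D; case: (z \in D) => /=; ring.
  (* Distinct classes are disjoint, so 0 is not an external difference. *)
  + rewrite mset_sumE big1 // => -[i j] /= /andP[_ ij].
    by rewrite Delta2E diff_count_disjoint0 ?disjC.
  + rewrite mset_sumE.
    rewrite (eq_bigr (fun w => diff_count (C w.1) (C w.2) z)); last first.
      by move=> w _; rewrite Delta2E.
    rewrite (eq_bigl (fun w => (w.1 \in I) && ((w.2 \in I) && (w.1 != w.2))));
      last by move=> [i j]; rewrite !inE andbA.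
    rewrite -(pair_big_dep (mem I) (fun i j => (j \in I) && (i != j))
      (fun i j => diff_count (C i) (C j) z)) /=.
    by rewrite sum_off // /family_union -/D; case: (z \in D) => /=; ring.
(* Hence [lambdaD = muD] means [eta * (2 * U - E) = 1] over the integers, which forces both factors
   to be 1 or both to be -1. *)
split=> //; have lm : lambdaD - muD = (2 * U - E) * eta - 1.
  by rewrite /lambdaD /muD; ring.
split=> [[_ ne] exc|nexc].
  case: ne; apply/eqP; rewrite -subr_eq0 lm.
  by case: exc => -[-> ->].
split=> [|lmE]; first by case: regD.
apply: nexc; have : eta * (2 * U - E) = 1.
  by apply/eqP; rewrite mulrC -subr_eq0 -lm lmE subrr.
exact: mulz_eq1.
Qed.
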